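(* Let $0<\underline\beta<\bar\beta$ and let $\alpha,\xi>0$, $\varphi$, $\omega$ and the sets $\mathcal{J}(\beta,D)$ be as in the context. Let $\mathcal{P}'$ be a parameter set such that $\mathcal{J}(\beta,D)\subset\mathcal{H}(\beta,\mathcal{P}')$ for every $\beta\in[\underline\beta,\bar\beta]$ and every positive even integer $D$. Suppose one observes i.i.d. random variables $X_1,\dots,X_n$ with common density $s$ on $\mathbb{R}$. Then for every $\beta\in[\underline\beta,\bar\beta]$ there exists a constant $\kappa_\beta>0$ such that for all $n\ge1$, $$\inf_{\tilde s}\ \sup_{s\in\mathcal{H}(\beta,\mathcal{P}')}\mathbb{E}_s\big[d_H^2(s,\tilde s)\big]\ \ge\ \kappa_\beta\, n^{-\frac{2\beta}{2\beta+1}},$$ where the infimum is over all estimators $\tilde s$ (measurable functions of $X_1,\dots,X_n$).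
   Context: $\psi(x)=\pi^{-1/2}e^{-x^2}$, $\psi_\sigma(x)=\sigma^{-1}\psi(x/\sigma)$. Hellinger distance: $d_H(g,h)=\frac{1}{\sqrt2}\|\sqrt g-\sqrt h\|_{L^2}$. For $\beta>0$, $r$ is the largest integer strictly less than $\beta$. A parameter set $\mathcal{P}=\{\gamma,l^+,L,\varepsilon,C,\alpha,\xi,M\}$ consists of a polynomial $L$ and constants $\gamma,l^+,\varepsilon,C,\alpha,\xi,M$; $\mathcal{H}(\beta,\mathcal{P})$ is the set of probability densities $f$ on $\mathbb{R}$ with: $\ln f$ $r$ times differentiable, $|(\ln f)^{(r)}(x)-(\ln f)^{(r)}(y)|\le r!L(x)|y-x|^{\beta-r}$ whenever $|x-y|\le\gamma$, $|(\ln f)^{(j)}(0)|\le l^+$ for $j=0,\dots,r$; $\int|(\ln f)^{(j)}|^{(2\beta+\varepsilon)/j}f\le C$ ($j=1,\dots,r$) and $\int|L|^{2+\varepsilon/\beta}f\le C$; $f\le M\psi$; $f>0$, $f$ nondecreasing on $(-\infty,-\alpha)$, nonincreasing on $(\alpha,\infty)$, $f\ge\xi$ on $[-\alpha,\alpha]$. Construction: $\varphi:\mathbb{R}\to\mathbb{R}$ is infinitely differentiable with compact support in $(1/4,3/4)$, $\int\varphi=0$, $\int\varphi^2=1$; $A=\max_{0\le k\le r+1}\|\varphi^{(k)}\|_\infty$, assumed $>1$. For a positive even integer $D$ and $j\in\{1,\dots,D\}$, $\varphi_j(x)=\frac{\xi D^{-\beta}}{A}\varphi\big(\frac{D}{\alpha}(x+\frac\alpha2)-(j-1)\big)$.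 $\mathcal{T}(\alpha,\xi)$ is the set of functions $\omega:\mathbb{R}\to\mathbb{R}^+$ nondecreasing on $(-\infty,-\alpha/2)$, nonincreasing on $(\alpha/2,\infty)$, with $\omega=2\xi$ on $[-3\alpha/4,3\alpha/4]$ and $\omega(-\alpha)=\omega(\alpha)=\xi$. Fix $\omega\in\mathcal{T}(\alpha,\xi)\cap\mathcal{H}(\beta,\tilde{\mathcal P})$ for every $\beta\in[\underline\beta,\bar\beta]$, where $\tilde{\mathcal P}=\{\alpha/4,\ln(2\xi),\tilde L,\tilde\varepsilon,\tilde C,\alpha,\xi,\tilde M\}$. For $\theta\in\{0,1\}^D$, $f_\theta(x)=\omega(x)+\sum_{j=1}^D(2\theta_j-1)\varphi_j(x)$, and $\mathcal{J}(\beta,D)=\{f_\theta:\theta\in\{0,1\}^D\}$. *)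

(* Defs.v *)
From HB Require Import structures.
From mathcomp Require Import all_boot all_order all_algebra.
From mathcomp Require Import all_classical all_reals all_analysis.
Set Implicit Arguments. Unset Strict Implicit. Unset Printing Implicit Defensive.
Import Order.TTheory GRing.Theory Num.Theory.
Import numFieldNormedType.Exports.
Local Open Scope classical_set_scope.
Local Open Scope ring_scope.

Section Defs.
Context {R : realType}.

Local Notation leb := (@lebesgue_measure R).

Definition psi (x : R) : R := (Num.sqrt pi)^-1 * expR (- x ^+ 2).

(* r = largest integer strictly less than beta (beta > 0) *)
Definition rof (beta : R) : nat := `|Num.ceil beta - 1|%N.

Definition hellinger2 (g h : R -> R) : \bar R :=
  (((2 : R)^-1)%:E * \int[leb]_x (((Num.sqrt (g x) - Num.sqrt (h x)) ^+ 2)%:E))%E.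

Record params := Params {
  p_gamma : R; p_lplus : R; p_L : {poly R}; p_eps : R;
  p_C : R; p_alpha : R; p_xi : R; p_M : R }.

Definition lnf (f : R -> R) : R -> R := fun x => ln (f x).

Definition Hclass (beta : R) (P : params) : set (R -> R) :=
  [set f : R -> R |
    [/\ measurable_fun setT f, (forall x, 0 <= f x)
      & (\int[leb]_x ((f x)%:E) = 1)%E] /\
    (forall j, (j < rof beta)%N -> forall x,
        derivable (derive1n j (lnf f)) x 1) /\
    (forall x y, `|x - y| <= p_gamma P ->
       `|derive1n (rof beta) (lnf f) x - derive1n (rof beta) (lnf f) y|
         <= (rof beta)`!%:R * (p_L P).[x]
            * `|y - x| `^ (beta - (rof beta)%:R)) /\
    (forall j, (j <= rof beta)%N -> `|derive1n j (lnf f) 0| <= p_lplus P) /\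
    (forall j, (1 <= j <= rof beta)%N ->
       (\int[leb]_x ((`|derive1n j (lnf f) x| `^ ((2 * beta + p_eps P) / j%:R)
                       * f x)%:E) <= (p_C P)%:E)%E) /\
    (\int[leb]_x ((`|(p_L P).[x]| `^ (2 + p_eps P / beta) * f x)%:E)
       <= (p_C P)%:E)%E /\
    (forall x, f x <= p_M P * psi x) /\
    (forall x, 0 < f x) /\
    (forall x y, x <= y -> y < - p_alpha P -> f x <= f y) /\
    (forall x y, p_alpha P < x -> x <= y -> f y <= f x) /\
    (forall x, - p_alpha P <= x <= p_alpha P -> p_xi P <= f x)].

Definition smooth (g : R -> R) : Prop :=
  forall k x, derivable (derive1n k g) x 1.

Definition supnorm (g : R -> R) : R := sup (range (fun x => `|g x|)).

Definition Aconst (phi : R -> R) (beta : R) : R :=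
  \big[Num.max/0]_(k < (rof beta).+2) supnorm (derive1n k phi).

(* phi_j, with 0-based index j : 'I_D standing for j+1 in the paper *)
Definition phij (phi : R -> R) (alpha xi beta : R) (D : nat) (j : nat)
  (x : R) : R :=
  xi * (D%:R `^ (- beta)) / Aconst phi beta
    * phi (D%:R / alpha * (x + alpha / 2) - j%:R).

Definition Tset (alpha xi : R) : set (R -> R) :=
  [set w : R -> R |
    (forall x, 0 <= w x) /\
    (forall x y, x <= y -> y < - (alpha / 2) -> w x <= w y) /\
    (forall x y, alpha / 2 < x -> x <= y -> w y <= w x) /\
    (forall x, - (3 * alpha / 4) <= x <= 3 * alpha / 4 -> w x = 2 * xi) /\
    w (- alpha) = xi /\ w alpha = xi].

Definition ftheta (omega phi : R -> R) (alpha xi beta : R) (D : nat)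
  (theta : 'I_D -> bool) (x : R) : R :=
  omega x + \sum_(j < D) (if theta j then 1 else -1)
                           * phij phi alpha xi beta D j x.

Definition Jset (omega phi : R -> R) (alpha xi beta : R) (D : nat)
  : set (R -> R) :=
  [set ftheta omega phi alpha xi beta theta | theta in [set: 'I_D -> bool]].

(* E_s[F(X_1,...,X_n)] for X_1..X_n iid with density s, as the iterated
   integral  \int s(x_1) \int s(x_2) ... F(x_1,...,x_n)  (F >= 0). *)
Fixpoint iexp (s : R -> R) (n : nat) : (n.-tuple R -> \bar R) -> \bar R :=
  match n return (n.-tuple R -> \bar R) -> \bar R with
  | 0 => fun F => F [tuple]
  | n'.+1 => fun F =>
      (\int[leb]_x ((s x)%:E * iexp s (fun t : n'.-tuple R => F (cons_tuple x t))))%E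
  end.

Definition estimator (n : nat) (est : n.-tuple R -> R -> R) : Prop :=
  measurable_fun setT (fun p : n.-tuple R * R => est p.1 p.2) /\
  (forall t y, 0 <= est t y).

Definition risk (n : nat) (s : R -> R) (est : n.-tuple R -> R -> R) : \bar R :=
  iexp s (fun t => hellinger2 s (est t)).

End Defs.

(* Main.v *)
Require Import Defs.
From HB Require Import structures.
From mathcomp Require Import all_boot all_order all_algebra.
From mathcomp Require Import all_classical all_reals all_analysis.
From mathcomp Require Import measurable_realfun ring lra.
Import Order.TTheory GRing.Theory Num.Theory.
Import numFieldNormedType.Exports.
Local Open Scope classical_set_scope.
Local Open Scope ring_scope.
Set Implicit Arguments.
Unset Strict Implicit.

(* Assouad's method.  The loss dominates the sum of its restrictions to the D
   cells carrying the bumps.  Flipping theta_j changes the density only on cell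
   j, from 2 xi + phi_j to 2 xi - phi_j, so the two restricted losses add up to
   at least e/4, while the affinity of the two densities is at least 1 - e,
   where e = \int phi_j^2 / (2 xi) is of order D^-(2 beta + 1).  If n e <= 1/4
   the n samples do not reveal theta_j, and averaging over the hypercube bounds
   the maximal risk below by D e / 32.  Taking D of order n^(1/(2 beta + 1))
   gives the rate. *)

(** * Iterated expectations *)

Section IteratedExpectation.
Context {R : realType}.
Implicit Types s h p q : R -> R.

Lemma iexp_ge0 s n (F : n.-tuple R -> \bar R) :
  (forall x, 0 <= s x) -> (forall t, (0 <= F t)%E) -> (0 <= iexp s F)%E.
Proof.
move=> s0; elim: n F => [|n IH] F F0 /=; first exact: F0.
by apply: integral_ge0 => x _; rewrite mule_ge0 ?lee_fin//; exact: IH.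
Qed.

(** The parameter space [T] is arbitrary so that the induction can move the first sample coordinate
    into it. Tonelli then gives measurability after that coordinate is integrated out. *)
Lemma measurable_iexp d (T : measurableType d) s n
    (F : T * n.-tuple R -> \bar R) :
  measurable_fun setT s -> (forall x, 0 <= s x) ->
  measurable_fun setT F -> (forall u, (0 <= F u)%E) ->
  measurable_fun setT (fun y => iexp s (fun t => F (y, t))).
Proof.
move=> ms s0; elim: n d T F => [|n IH] d T F mF F0 /=.
  by apply: (measurableT_comp mF); exact: measurable_fun_pair.
pose G (u : T * R) :=
  ((s u.2)%:E * iexp s (fun t : n.-tuple R => F (u.1, cons_tuple u.2 t)))%E.
apply: (measurable_fun_fubini_tonelli_F (m2 := lebesgue_measure) G); last first.
  by move=> u; rewrite /G mule_ge0 ?lee_fin//; exact: iexp_ge0.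
apply: emeasurable_funM.
  by apply/measurable_EFinP; exact: (measurableT_comp ms).
apply: (IH _ _ (fun w : (T * R) * n.-tuple R =>
  F (w.1.1, cons_tuple w.1.2 w.2))) => //.
apply: (measurableT_comp mF); apply: measurable_fun_pair.
  exact: measurableT_comp.
by apply: measurable_cons => //; exact: measurableT_comp.
Qed.

Lemma measurable_iexp_cons s n (F : n.+1.-tuple R -> \bar R) :
  measurable_fun setT s -> (forall x, 0 <= s x) ->
  measurable_fun setT F -> (forall t, (0 <= F t)%E) ->
  measurable_fun setT (fun x => iexp s (fun t => F (cons_tuple x t))).
Proof.
move=> ms s0 mF F0.
apply: (@measurable_iexp _ _ s n (fun u => F (cons_tuple u.1 u.2))) => //.
by apply: (measurableT_comp mF); exact: measurable_cons.
Qed.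

Lemma measurable_cons_tuple n (F : n.+1.-tuple R -> \bar R) x :
  measurable_fun setT F -> measurable_fun setT (fun t => F (cons_tuple x t)).
Proof. by move=> mF; apply: (measurableT_comp mF); exact: measurable_cons. Qed.

Lemma le_iexp s n (F G : n.-tuple R -> \bar R) :
  measurable_fun setT s -> (forall x, 0 <= s x) ->
  measurable_fun setT F -> (forall t, (0 <= F t)%E) ->
  measurable_fun setT G -> (forall t, (F t <= G t)%E) ->
  (iexp s F <= iexp s G)%E.
Proof.
move=> ms s0; elim: n F G => [|n IH] F G mF F0 mG FG /=; first exact: FG.
have G0 t : (0 <= G t)%E by apply: le_trans (FG t).
apply: ge0_le_integral => //.
- by move=> x _; rewrite mule_ge0 ?lee_fin//; exact: iexp_ge0.
- by apply: emeasurable_funM; [exact/measurable_EFinP | exact: measurable_iexp_cons].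
- by apply: emeasurable_funM; [exact/measurable_EFinP | exact: measurable_iexp_cons].
- move=> x _; apply: lee_pmul => //; first by rewrite lee_fin.
    exact: iexp_ge0.
  by apply: IH => //; exact: measurable_cons_tuple.
Qed.

Lemma iexpD s n (F G : n.-tuple R -> \bar R) :
  measurable_fun setT s -> (forall x, 0 <= s x) ->
  measurable_fun setT F -> (forall t, (0 <= F t)%E) ->
  measurable_fun setT G -> (forall t, (0 <= G t)%E) ->
  iexp s (fun t => F t + G t)%E = (iexp s F + iexp s G)%E.
Proof.
move=> ms s0; elim: n F G => [|n IH] F G mF F0 mG G0 //=.
rewrite -ge0_integralD//.
- apply: eq_integral => x _; rewrite -ge0_muleDr ?iexp_ge0//.
  by congr (_ * _)%E; apply: IH => //; exact: measurable_cons_tuple.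
- by move=> x _; rewrite mule_ge0 ?lee_fin//; exact: iexp_ge0.
- by apply: emeasurable_funM; [exact/measurable_EFinP | exact: measurable_iexp_cons].
- by move=> x _; rewrite mule_ge0 ?lee_fin//; exact: iexp_ge0.
- by apply: emeasurable_funM; [exact/measurable_EFinP | exact: measurable_iexp_cons].
Qed.

Lemma iexp_sum s n (I : Type) (r : seq I) (F : I -> n.-tuple R -> \bar R) :
  measurable_fun setT s -> (forall x, 0 <= s x) ->
  (forall i, measurable_fun setT (F i)) -> (forall i t, (0 <= F i t)%E) ->
  iexp s (fun t => \sum_(i <- r) F i t)%E = (\sum_(i <- r) iexp s (F i))%E.
Proof.
move=> ms s0 mF F0; elim: r => [|i r IH].
  under eq_fun do rewrite big_nil.
  rewrite big_nil; elim: n {F mF F0} => [|n IHn] //=.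
  by apply: integral0_eq => x _; rewrite IHn mule0.
under eq_fun do rewrite big_cons.
rewrite iexpD ?big_cons ?IH//; first exact: emeasurable_sum.
by move=> t; exact: sume_ge0.
Qed.

Lemma iexpZl s n (k : R) (F : n.-tuple R -> \bar R) :
  measurable_fun setT s -> (forall x, 0 <= s x) -> 0 <= k ->
  measurable_fun setT F -> (forall t, (0 <= F t)%E) ->
  iexp s (fun t => k%:E * F t)%E = (k%:E * iexp s F)%E.
Proof.
move=> ms s0 k0; elim: n F => [|n IH] F mF F0 //=.
rewrite -ge0_integralZl_EFin//.
- apply: eq_integral => x _; rewrite muleCA.
  by congr (_ * _)%E; apply: IH => //; exact: measurable_cons_tuple.
- by move=> x _; rewrite mule_ge0 ?lee_fin//; exact: iexp_ge0.
- by apply: emeasurable_funM; [exact/measurable_EFinP | exact: measurable_iexp_cons].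
Qed.

Lemma measurable_tuple_prod s n : measurable_fun setT s ->
  measurable_fun setT (fun t : n.-tuple R => \prod_(x <- t) s x).
Proof.
move=> ms; under eq_fun do rewrite big_tuple.
apply: measurable_prod => i _.
by apply: (measurableT_comp ms); exact: measurable_tnth.
Qed.

(** The n-fold product density becomes a weight against iterated Lebesgue integration. Expectations
    under two different densities can then be added and compared inside one integral. *)
Lemma iexp_density s n (F : n.-tuple R -> \bar R) :
  measurable_fun setT s -> (forall x, 0 <= s x) ->
  measurable_fun setT F -> (forall t, (0 <= F t)%E) ->
  iexp s F = iexp (cst 1) (fun t => (\prod_(x <- t) s x)%:E * F t)%E.
Proof.
move=> ms s0; elim: n F => [|n IH] F mF F0 /=; first by rewrite big_nil mul1e.
apply: eq_integral => x _; rewrite mul1e IH//; last exact: measurable_cons_tuple.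
rewrite -iexpZl//; last 2 first.
- apply: emeasurable_funM; last exact: measurable_cons_tuple.
  by apply/measurable_EFinP; exact: measurable_tuple_prod.
- by move=> t; rewrite mule_ge0 ?lee_fin// prodr_ge0.
by congr iexp; apply/funext => t /=; rewrite big_cons EFinM muleA.
Qed.

(** The total mass r is not fixed to 1: the rule serves both for densities and for h = sqrt(p q),
    whose n-fold product has mass r^n. *)
Lemma iexp_cst h n (r c : R) :
  measurable_fun setT h -> (forall x, 0 <= h x) -> 0 <= c ->
  (\int[lebesgue_measure]_x (h x)%:E = r%:E)%E ->
  iexp h (fun _ : n.-tuple R => c%:E) = (r ^+ n * c)%:E.
Proof.
move=> mh h0 c0 hr; elim: n => [|n IH] /=; first by rewrite expr0 mul1r.
have r0 : 0 <= r by rewrite -lee_fin -hr; apply: integral_ge0 => x _; rewrite lee_fin.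
under eq_integral do rewrite IH.
rewrite ge0_integralZr//=.
- by rewrite hr -EFinM exprS mulrA.
- exact/measurable_EFinP.
- by move=> x _; rewrite lee_fin.
- by rewrite lee_fin mulr_ge0 ?exprn_ge0.
Qed.

(** * Two-point inequality for n-fold products *)

Lemma measurable_sqrt : measurable_fun setT (@Num.sqrt R).
Proof. by apply: continuous_measurable_fun; exact: sqrt_continuous. Qed.

(* Integrating the pointwise bound avoids any Cauchy-Schwarz inequality between
   the total variation and the Hellinger affinity of the n-fold products. *)
Lemma two_point_pointwise (p q d : R) (a b : \bar R) :
  0 < p -> 0 < q -> 0 <= d -> (0 <= a)%E -> (0 <= b)%E -> (d%:E <= a + b)%E ->
  ((4 * d)%:E * (Num.sqrt (p * q))%:E <=
    4%:E * (p%:E * a + q%:E * b) + (d * p + d * q)%:E)%E.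
Proof.
(* If either loss is infinite, positivity of [p] and [q] makes the right side infinite. *)
move=> p0 q0 d0; case: a => [a| |]//; case: b => [b| |]// a0 b0 dab; last 3 first.
- by rewrite gt0_muley ?lte_fin// addey// gt0_muley ?lte_fin// addye// leey.
- by rewrite gt0_muley ?lte_fin// addye// gt0_muley ?lte_fin// addye// leey.
- by rewrite !gt0_muley ?lte_fin// addye// leey.
move: a0 b0 dab; rewrite -!(EFinM, EFinD) !lee_fin => a0 b0 dab.
rewrite sqrtrM; last exact: ltW.
have := sqr_sqrtr (ltW p0); have := sqr_sqrtr (ltW q0).
have := sqrtr_ge0 p; have := sqrtr_ge0 q.
set u := Num.sqrt p; set v := Num.sqrt q => v0 u0 <- <-.
(* In both cases p a + q b dominates d min(p, q). Also 4 d u v is at most 4 d times the smaller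
   square plus d times the larger one, since (2 min(u, v) - max(u, v))^2 >= 0. *)
have [uv|/ltW uv] := leP u v.
  have uv2 : u ^+ 2 <= v ^+ 2 by rewrite ler_pXn2r.
  have k : d * u ^+ 2 <= u ^+ 2 * a + v ^+ 2 * b.
    have := ler_wpM2r b0 uv2; have := ler_wpM2l (sqr_ge0 u) dab; lra.
  have k2 : 4 * d * (u * v) <= 4 * (d * u ^+ 2) + d * v ^+ 2.
    have := mulr_ge0 d0 (sqr_ge0 (2 * u - v)); lra.
  have := mulr_ge0 d0 (sqr_ge0 u); lra.
have uv2 : v ^+ 2 <= u ^+ 2 by rewrite ler_pXn2r.
have k : d * v ^+ 2 <= u ^+ 2 * a + v ^+ 2 * b.
  have := ler_wpM2r a0 uv2; have := ler_wpM2l (sqr_ge0 v) dab; lra.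
have k2 : 4 * d * (u * v) <= 4 * (d * v ^+ 2) + d * u ^+ 2.
  have := mulr_ge0 d0 (sqr_ge0 (2 * v - u)); lra.
have := mulr_ge0 d0 (sqr_ge0 v); lra.
Qed.

(** The pointwise inequality is integrated with the product densities in place of p and q. The
    affinity tensorises to r^n, so the bound is informative once r^n exceeds 1/2. *)
Lemma iexp_two_point p q n (a b : n.-tuple R -> \bar R) (d r : R) :
  measurable_fun setT p -> (forall x, 0 < p x) ->
  measurable_fun setT q -> (forall x, 0 < q x) ->
  (\int[lebesgue_measure]_x (p x)%:E = 1)%E ->
  (\int[lebesgue_measure]_x (q x)%:E = 1)%E ->
  (\int[lebesgue_measure]_x (Num.sqrt (p x * q x))%:E = r%:E)%E ->
  measurable_fun setT a -> (forall t, (0 <= a t)%E) ->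
  measurable_fun setT b -> (forall t, (0 <= b t)%E) ->
  0 <= d -> (forall t, (d%:E <= a t + b t)%E) ->
  ((4 * d * r ^+ n)%:E <= 4%:E * (iexp p a + iexp q b) + (2 * d)%:E)%E.
Proof.
move=> mp p0 mq q0 ip iq ir ma a0 mb b0 d0 dab.
have {}p0' x := ltW (p0 x); have {}q0' x := ltW (q0 x).
pose h x := Num.sqrt (p x * q x).
have mh : measurable_fun setT h.
  by apply: (measurableT_comp measurable_sqrt); exact: measurable_funM.
have h0 x : 0 <= h x by exact: sqrtr_ge0.
pose pr s (t : n.-tuple R) := \prod_(x <- t) s x.
have mpr s : measurable_fun setT s -> measurable_fun setT (fun t => (pr s t)%:E).
  by move=> ms; apply/measurable_EFinP; exact: measurable_tuple_prod.
have pr0 s t : (forall x, 0 <= s x) -> (0 <= (pr s t)%:E)%E.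
  by move=> s0; rewrite lee_fin prodr_ge0.
(* A constant is its own expectation under a density; this turns the term 2 d into an integral over
   samples. *)
have E s : measurable_fun setT s -> (forall x, 0 <= s x) ->
    (\int[lebesgue_measure]_x (s x)%:E = 1)%E ->
    d%:E = iexp (cst 1) (fun t => (pr s t)%:E * d%:E)%E.
  move=> ms s0 is1; rewrite -iexp_density//.
  by rewrite (iexp_cst _ ms s0 _ is1)// expr1n mul1r.
have Eh : (4 * d * r ^+ n)%:E = iexp (cst 1) (fun t => (pr h t)%:E * (4 * d)%:E)%E.
  rewrite -iexp_density//; last by move=> _; rewrite lee_fin mulr_ge0.
  by rewrite (iexp_cst _ mh _ _ ir) ?mulr_ge0// mulrC.
have mM s c : measurable_fun setT s -> measurable_fun setT c ->
    measurable_fun setT (fun t => (pr s t)%:E * c t)%E.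
  by move=> ms mc; apply: emeasurable_funM => //; exact: mpr.
have M0 s c t : (forall x, 0 <= s x) -> (0 <= c t -> 0 <= (pr s t)%:E * c t)%E.
  by move=> s0 c0; rewrite mule_ge0// pr0.
pose A t := ((pr p t)%:E * a t + (pr q t)%:E * b t)%E.
pose B t := ((pr p t)%:E * d%:E + (pr q t)%:E * d%:E)%E.
have mA : measurable_fun setT A by apply: emeasurable_funD; exact: mM.
have mB : measurable_fun setT B.
  by apply: emeasurable_funD; apply: mM => //; exact: measurable_cst.
have A0 t : (0 <= A t)%E by rewrite adde_ge0// M0.
have B0 t : (0 <= B t)%E by rewrite adde_ge0// (M0 _ (cst d%:E)).
have EA : iexp p a + iexp q b = iexp (cst 1) A.
  rewrite (iexp_density mp)// (iexp_density mq)// -iexpD//; first exact: mM.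
  - by move=> t; exact: M0.
  - exact: mM.
  - by move=> t; exact: M0.
have EB : (2 * d)%:E = iexp (cst 1) B.
  rewrite iexpD//; last 4 first.
  - by apply: mM => //; exact: measurable_cst.
  - by move=> t; rewrite (M0 _ (cst d%:E)).
  - by apply: mM => //; exact: measurable_cst.
  - by move=> t; rewrite (M0 _ (cst d%:E)).
  by rewrite -(E p)// -(E q)// -EFinD; congr EFin; ring.
rewrite Eh EA EB -iexpZl// -iexpD//; last 2 first.
- exact: measurable_funeM.
- by move=> t; rewrite mule_ge0.
apply: le_iexp => //.
- by apply: (mM _ (cst (4 * d)%:E)) => //; exact: measurable_cst.
- by move=> t; apply: (M0 _ (cst (4 * d)%:E)) => //; rewrite lee_fin mulr_ge0.
- by apply: emeasurable_funD => //; exact: measurable_funeM.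
move=> t; rewrite muleC.
(* The square root of a product of nonnegative factors is the product of their square roots, which
   is the tensorisation of the affinity. *)
have -> : pr h t = Num.sqrt (pr p t * pr q t).
  rewrite /pr -big_split/=; elim: (tval t) => [|x l IH].
    by rewrite !big_nil sqrtr1.
  by rewrite !big_cons sqrtrM ?IH// mulr_ge0.
rewrite /B -!EFinM -EFinD ![pr _ t * d]mulrC EFinM.
by apply: two_point_pointwise => //; rewrite /pr prodr_gt0.
Qed.

End IteratedExpectation.

(** * Two-point bound on a cell *)

Section LocalLoss.
Context {R : realType}.
Implicit Types g h p q w : R -> R.
Local Notation leb := (@lebesgue_measure R).

Definition local_loss (E : set R) g h : \bar R :=
  ((2 : R)^-1%:E *
    \int[leb]_x ((\1_E x * (Num.sqrt (g x) - Num.sqrt (h x)) ^+ 2)%:E))%E.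

Lemma measurable_sqrt_diff2 g h : measurable_fun setT g -> measurable_fun setT h ->
  measurable_fun setT (fun x => (Num.sqrt (g x) - Num.sqrt (h x)) ^+ 2).
Proof.
move=> mg mh; apply: measurable_funX; apply: measurable_funB;
  exact: (measurableT_comp measurable_sqrt).
Qed.

Lemma measurable_local_integrand (E : set R) g h :
  measurable E -> measurable_fun setT g -> measurable_fun setT h ->
  measurable_fun setT
    (fun x => (\1_E x * (Num.sqrt (g x) - Num.sqrt (h x)) ^+ 2)%:E).
Proof.
move=> mE mg mh; apply/measurable_EFinP; apply: measurable_funM.
  exact: measurable_indic.
exact: measurable_sqrt_diff2.
Qed.

Lemma local_integrand_ge0 (E : set R) g h x :
  0 <= \1_E x * (Num.sqrt (g x) - Num.sqrt (h x)) ^+ 2.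
Proof. by rewrite mulr_ge0 ?sqr_ge0// indicE. Qed.

Lemma local_loss_ge0 (E : set R) g h : (0 <= local_loss E g h)%E.
Proof.
rewrite mule_ge0 ?lee_fin ?invr_ge0//; apply: integral_ge0 => x _.
by rewrite lee_fin local_integrand_ge0.
Qed.

Lemma sum_indic_le1 (T : Type) (I : finType) (E : I -> set T) (x : T) :
  trivIset setT E -> \sum_i \1_(E i) x <= 1 :> R.
Proof.
move=> tE; have [[i Eix]|noE] := pselect (exists i, E i x).
  rewrite (bigD1 i)//= big1 ?addr0 ?indicE ?lern1 ?leq_b1// => k ki.
  rewrite indicE memNset// => Ekx; move/eqP: ki; apply.
  by apply: (tE k i) => //; exists x.
by rewrite big1// => i _; rewrite indicE memNset// => Eix; apply: noE; exists i.
Qed.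

Lemma sum_local_loss_le (I : finType) (E : I -> set R) g h :
  (forall i, measurable (E i)) -> trivIset setT E ->
  measurable_fun setT g -> measurable_fun setT h ->
  (\sum_i local_loss (E i) g h <= hellinger2 g h)%E.
Proof.
move=> mE tE mg mh; rewrite -ge0_sume_distrr; last first.
  by move=> i _; apply: integral_ge0 => x _; rewrite lee_fin local_integrand_ge0.
apply: lee_wpmul2l; first by rewrite lee_fin invr_ge0.
rewrite -ge0_integral_sum//; last 2 first.
- by move=> i; exact: measurable_local_integrand.
- by move=> i x _; rewrite lee_fin local_integrand_ge0.
apply: ge0_le_integral => //.
- by move=> x _; apply: sume_ge0 => i _; rewrite lee_fin local_integrand_ge0.
- by apply: emeasurable_sum => i; exact: measurable_local_integrand.
- by apply/measurable_EFinP; exact: measurable_sqrt_diff2.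
- move=> x _; rewrite sumEFin lee_fin -mulr_suml.
  by rewrite ler_piMl ?sqr_ge0// sum_indic_le1.
Qed.

(** Tonelli applies because an estimator is jointly measurable in the sample and the evaluation
    point. *)
Lemma measurable_local_loss n (E : set R) g (est : n.-tuple R -> R -> R) :
  measurable E -> measurable_fun setT g -> estimator est ->
  measurable_fun setT (fun t => local_loss E g (est t)).
Proof.
move=> mE mg [mest _]; apply: measurable_funeM.
pose G (u : n.-tuple R * R) :=
  (\1_E u.2 * (Num.sqrt (g u.2) - Num.sqrt (est u.1 u.2)) ^+ 2)%:E.
apply: (measurable_fun_fubini_tonelli_F (m2 := leb) G).
  apply/measurable_EFinP; apply: measurable_funM.
    by apply: (measurableT_comp (measurable_indic mE)).
  apply: measurable_funX; apply: measurable_funB.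
    by apply: (measurableT_comp measurable_sqrt); exact: (measurableT_comp mg).
  exact: (measurableT_comp measurable_sqrt).
by move=> u; rewrite lee_fin local_integrand_ge0.
Qed.

(** Put z = w^2 / (2 xi). The geometric mean s satisfies s^2 = 4 xi^2 - 2 xi z, and comparing
    squares gives 2 xi - z <= s <= 2 xi - z / 2. The lower bound is the affinity claim; the upper
    one gives the gap, because the squared difference equals 4 xi - 2 s. *)
Lemma sqrt_symmetric_gap (xi w : R) : 0 < xi -> `|w| <= xi ->
  w ^+ 2 / (2 * xi) <= (Num.sqrt (2 * xi + w) - Num.sqrt (2 * xi - w)) ^+ 2 /\
  2 * xi - w ^+ 2 / (2 * xi) <= Num.sqrt ((2 * xi + w) * (2 * xi - w)).
Proof.
move=> xi0; rewrite ler_norml => /andP[w1 w2].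
have p0 : 0 <= 2 * xi + w by lra.
have q0 : 0 <= 2 * xi - w by lra.
pose z := w ^+ 2 / (2 * xi).
have z0 : 0 <= z by rewrite divr_ge0 ?sqr_ge0//; lra.
have zE : w ^+ 2 = 2 * xi * z by rewrite /z; field; lra.
have z1 : z <= xi by rewrite /z ler_pdivrMr; nra.
rewrite -/z; set s := Num.sqrt ((2 * xi + w) * (2 * xi - w)).
have s0 : 0 <= s by exact: sqrtr_ge0.
have sE : s ^+ 2 = 4 * xi ^+ 2 - w ^+ 2 by rewrite sqr_sqrtr ?mulr_ge0//; ring.
have z2 : 0 <= z * (xi - z) by rewrite mulr_ge0// subr_ge0.
split; last first.
  by rewrite -(@ler_pXn2r _ 2) ?nnegrE//; [rewrite sE zE | ]; nra.
have -> : (Num.sqrt (2 * xi + w) - Num.sqrt (2 * xi - w)) ^+ 2 = 4 * xi - 2 * s.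
  by rewrite sqrrB !sqr_sqrtr// -sqrtrM// -/s; ring.
suff : s <= 2 * xi - z / 2 by lra.
rewrite -(@ler_pXn2r _ 2) ?nnegrE//; [rewrite sE zE | ]; nra.
Qed.

(** The sign of the bump is absorbed into [w]. Since [w] vanishes off [E], integrals of w^2 can run
    over the whole line. *)
Definition symmetric_pair (E : set R) (xi : R) w p q : Prop :=
  forall x, `|w x| <= xi /\
    ((E x /\ p x = 2 * xi + w x /\ q x = 2 * xi - w x) \/
     (~ E x /\ p x = q x /\ w x = 0)).

Lemma symmetric_pair_gap E xi w p q (eta : R) : 0 < xi ->
  measurable E -> measurable_fun setT p -> measurable_fun setT q ->
  measurable_fun setT w -> symmetric_pair E xi w p q ->
  (\int[leb]_x (w x ^+ 2 / (2 * xi))%:E = eta%:E)%E ->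
  (eta%:E <= \int[leb]_x (\1_E x * (Num.sqrt (p x) - Num.sqrt (q x)) ^+ 2)%:E)%E.
Proof.
move=> xi0 mE mp mq mw pq <-.
apply: ge0_le_integral => //.
- by move=> x _; rewrite lee_fin divr_ge0 ?sqr_ge0//; lra.
- apply/measurable_EFinP; apply: measurable_funM; first exact: measurable_funX.
  exact: measurable_cst.
- exact: measurable_local_integrand.
- move=> x _; rewrite lee_fin indicE.
  case: (pq x) => wx [[Ex [-> ->]]|[Ex [-> ->]]].
    by rewrite mem_set// mul1r; case: (sqrt_symmetric_gap xi0 wx).
  by rewrite memNset// mul0r expr0n/= mul0r.
Qed.

(** The mean m = (p + q) / 2 has integral 1 and satisfies sqrt(p q) <= m <= sqrt(p q) + w^2 / (2
    xi). The first inequality makes the affinity finite, the second bounds it below. *)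
Lemma symmetric_pair_affinity E xi w p q (eta : R) : 0 < xi ->
  measurable_fun setT p -> measurable_fun setT q ->
  measurable_fun setT w -> symmetric_pair E xi w p q ->
  (forall x, 0 < p x) -> (forall x, 0 < q x) ->
  (\int[leb]_x (p x)%:E = 1)%E -> (\int[leb]_x (q x)%:E = 1)%E ->
  (\int[leb]_x (w x ^+ 2 / (2 * xi))%:E = eta%:E)%E ->
  exists2 r, (\int[leb]_x (Num.sqrt (p x * q x))%:E = r%:E)%E & 1 - eta <= r.
Proof.
move=> xi0 mp mq mw pq p0 q0 ip iq iw.
pose s x := Num.sqrt (p x * q x).
have ms : measurable_fun setT s.
  by apply: (measurableT_comp measurable_sqrt); exact: measurable_funM.
pose m x := 2^-1 * (p x + q x).
have mm : measurable_fun setT m.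
  by apply: measurable_funM; [exact: measurable_cst | exact: measurable_funD].
have m0 x : 0 <= m x by rewrite /m mulr_ge0 ?addr_ge0 ?ltW.
have im : (\int[leb]_x (m x)%:E = 1)%E.
  under eq_integral do rewrite EFinM EFinD.
  rewrite ge0_integralZl_EFin//; last 2 first.
  - by move=> x _; rewrite lee_fin addr_ge0 ?ltW.
  - by apply: emeasurable_funD; exact/measurable_EFinP.
  rewrite ge0_integralD//; last 4 first.
  - by move=> x _; rewrite lee_fin ltW.
  - exact/measurable_EFinP.
  - by move=> x _; rewrite lee_fin ltW.
  - exact/measurable_EFinP.
  by rewrite ip iq -EFinD -EFinM; congr EFin; lra.
have sm x : s x <= m x.
  have u0 : 0 <= m x ^+ 2 by exact: sqr_ge0.
  have -> : m x = Num.sqrt (m x ^+ 2) by rewrite sqrtr_sqr ger0_norm.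
  rewrite ler_sqrt// /m; have := sqr_ge0 (p x - q x); nra.
have sint : (\int[leb]_x (s x)%:E <= 1)%E.
  rewrite -im; apply: ge0_le_integral => //.
  - by move=> x _; rewrite lee_fin sqrtr_ge0.
  - exact/measurable_EFinP.
  - exact/measurable_EFinP.
  - by move=> x _; rewrite lee_fin.
have mw2 : measurable_fun setT (fun x => (w x ^+ 2 / (2 * xi))%:E).
  apply/measurable_EFinP; apply: measurable_funM; first exact: measurable_funX.
  exact: measurable_cst.
have w20 x : 0 <= w x ^+ 2 / (2 * xi) by rewrite divr_ge0 ?sqr_ge0//; lra.
have key : (1 <= \int[leb]_x (s x)%:E + eta%:E)%E.
  rewrite -iw -ge0_integralD//; last 3 first.
  - by move=> x _; rewrite lee_fin sqrtr_ge0.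
  - exact/measurable_EFinP.
  - by move=> x _; rewrite lee_fin.
  rewrite -[leLHS]im; apply: ge0_le_integral => //.
  - by move=> x _; rewrite lee_fin.
  - exact/measurable_EFinP.
  - by apply: emeasurable_funD => //; exact/measurable_EFinP.
  - move=> x _; rewrite -EFinD lee_fin /m /s.
    case: (pq x) => wx [[Ex [-> ->]]|[Ex [pqx ->]]].
      by case: (sqrt_symmetric_gap xi0 wx) => _; lra.
    rewrite pqx expr0n/= mul0r addr0 -expr2 sqrtr_sqr ger0_norm; [lra | exact: ltW].
have s0 : (0 <= \int[leb]_x (s x)%:E)%E.
  by apply: integral_ge0 => x _; rewrite lee_fin sqrtr_ge0.
move: sint key s0; rewrite -/s; case: (\int[leb]_x (s x)%:E)%E => [r| |]//.
rewrite -EFinD !lee_fin => r1 key r0.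
by exists r => //; lra.
Qed.

(** For the square roots a, b, c of p, q, h one has (a - c)^2 + (b - c)^2 >= (a - b)^2 / 2, the
    difference being (a + b - 2 c)^2 / 2. This 1/2 and the 1/2 in the Hellinger distance give eta /
    4. *)
Lemma local_loss_pair E xi w p q h (eta : R) : 0 < xi ->
  measurable E -> measurable_fun setT p -> measurable_fun setT q ->
  measurable_fun setT h ->
  measurable_fun setT w -> symmetric_pair E xi w p q ->
  (\int[leb]_x (w x ^+ 2 / (2 * xi))%:E = eta%:E)%E ->
  ((eta / 4)%:E <= local_loss E p h + local_loss E q h)%E.
Proof.
move=> xi0 mE mp mq mh mw pq iw.
have I0 g x : setT x ->
    (0 <= (\1_E x * (Num.sqrt (g x) - Num.sqrt (h x)) ^+ 2)%:E)%E.
  by move=> _; rewrite lee_fin local_integrand_ge0.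
rewrite -ge0_muleDr; try by apply: integral_ge0 => x; exact: I0.
rewrite -ge0_integralD//; try exact: measurable_local_integrand;
  try by move=> x; exact: I0.
have -> : (eta / 4)%:E = (2^-1%:E * (2^-1%:E * eta%:E))%E.
  by rewrite -!EFinM; congr EFin; lra.
apply: lee_wpmul2l; first by rewrite lee_fin invr_ge0.
apply: (@le_trans _ _ (2^-1%:E *
  \int[leb]_x (\1_E x * (Num.sqrt (p x) - Num.sqrt (q x)) ^+ 2)%:E)%E).
  apply: lee_wpmul2l; first by rewrite lee_fin invr_ge0.
  exact: (symmetric_pair_gap xi0 mE mp mq mw pq iw).
rewrite -ge0_integralZl_EFin ?invr_ge0//; last 2 first.
- by move=> x _; rewrite lee_fin local_integrand_ge0.
- exact: measurable_local_integrand.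
apply: ge0_le_integral => //.
- by move=> x _; rewrite -EFinM lee_fin mulr_ge0 ?invr_ge0 ?local_integrand_ge0.
- by apply: measurable_funeM; exact: measurable_local_integrand.
- by apply: emeasurable_funD; exact: measurable_local_integrand.
- move=> x _; rewrite -EFinM -EFinD lee_fin -mulrDr mulrCA.
  apply: ler_wpM2l; first by rewrite indicE.
  set a := Num.sqrt (p x); set b := Num.sqrt (q x); set c := Num.sqrt (h x).
  have := sqr_ge0 (a + b - 2 * c); lra.
Qed.

(** The two-point inequality with d = eta / 4 reads eta r^n <= 4 X + eta / 2, where X is the sum of
    the two risks. With r^n >= 3/4 this leaves X >= eta / 16. *)
Lemma two_point_risk n (est : n.-tuple R -> R -> R) E xi w p q (eta : R) :
  0 < xi -> estimator est -> measurable E ->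
  measurable_fun setT p -> measurable_fun setT q ->
  measurable_fun setT w -> symmetric_pair E xi w p q ->
  (forall x, 0 < p x) -> (forall x, 0 < q x) ->
  (\int[leb]_x (p x)%:E = 1)%E -> (\int[leb]_x (q x)%:E = 1)%E ->
  (\int[leb]_x (w x ^+ 2 / (2 * xi))%:E = eta%:E)%E ->
  n%:R * eta <= 4^-1 -> eta <= 1 ->
  ((eta / 16)%:E <= iexp p (fun t => local_loss E p (est t)) +
                    iexp q (fun t => local_loss E q (est t)))%E.
Proof.
move=> xi0 est_ mE mp mq mw pq p0 q0 ip iq iw neta eta1.
have eta0 : 0 <= eta.
  rewrite -lee_fin -iw; apply: integral_ge0 => x _.
  by rewrite lee_fin divr_ge0 ?sqr_ge0//; lra.
have [r ir r1] := symmetric_pair_affinity xi0 mp mq mw pq p0 q0 ip iq iw.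
have rn : 3 / 4 <= r ^+ n.
  apply: (@le_trans _ _ ((1 - eta) ^+ n)); last first.
    by apply: lerXn2r; rewrite ?nnegrE; lra.
  (* Bernoulli's inequality; [eta <= 1] keeps the base 1 - eta nonnegative. *)
  have bern k : 1 - k%:R * eta <= (1 - eta) ^+ k.
    elim: k => [|k IH]; first by rewrite expr0; lra.
    rewrite exprS; apply: (@le_trans _ _ ((1 - eta) * (1 - k%:R * eta))).
      have := mulr_ge0 (ler0n R k) (sqr_ge0 eta); rewrite -natr1; lra.
    by apply: ler_wpM2l => //; lra.
  by apply: le_trans (bern n); lra.
have d0 : 0 <= eta / 4 by lra.
have mest t : measurable_fun setT (est t).
  by case: est_ => me _; exact: (measurableT_comp me (pair1_measurable t)).
have := iexp_two_point mp p0 mq q0 ip iq ir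
  (measurable_local_loss mE mp est_) (fun t => local_loss_ge0 E p (est t))
  (measurable_local_loss mE mq est_) (fun t => local_loss_ge0 E q (est t))
  d0 (fun t => local_loss_pair xi0 mE mp mq (mest t) mw pq iw).
set X := (iexp p _ + iexp q _)%E.
have : (0 <= X)%E.
  have L0 s g : (forall x, 0 < s x) -> (0 <= iexp s (fun t => local_loss E g (est t)))%E.
    by move=> s0; apply: iexp_ge0 => [x|t]; [exact: ltW | exact: local_loss_ge0].
  by rewrite /X adde_ge0// L0.
case: X => [X| |]//; last by move=> *; rewrite leey.
rewrite -EFinM -EFinD !lee_fin => X0.
have := ler_wpM2l eta0 rn; lra.
Qed.

End LocalLoss.

(** * Hypercube of bump perturbations *)

Section Assouad.
Context {R : realType}.

(** Finite functions make the hypercube a finite type, so averages over it are finite sums; [ftheta]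
    itself takes plain functions. *)
Definition flip (D : nat) (j : 'I_D) (theta : {ffun 'I_D -> bool}) :
  {ffun 'I_D -> bool} := [ffun k => if k == j then ~~ theta k else theta k].

Lemma flipK (D : nat) (j : 'I_D) : involutive (flip j).
Proof.
by move=> theta; apply/ffunP => k; rewrite !ffunE; case: eqP => // _; rewrite negbK.
Qed.

(** The maximum is at least the average over theta. For fixed j the involution [flip j] permutes the
    hypercube, so twice the sum of rk j over theta is at least N e, with N the number of vertices;
    summing over j gives D e / 2. *)
Lemma assouad (D : nat) (rk : 'I_D -> {ffun 'I_D -> bool} -> \bar R)
    (m : \bar R) (e : R) :
  (forall j theta, (0 <= rk j theta)%E) ->
  (forall theta, (\sum_j rk j theta <= m)%E) ->
  (forall j theta, (e%:E <= rk j theta + rk j (flip j theta))%E) ->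
  ((D%:R * e / 2)%:E <= m)%E.
Proof.
(* The value +oo is trivial and -oo contradicts nonnegativity. A finite m makes every term finite,
   so the averaging takes place in the reals. *)
move=> rk0 rkm rke; case: m rkm => [m| |] rkm; last 2 first.
- by rewrite leey.
- have := rkm [ffun=> true]; rewrite leeNy_eq => /eqP rkNy.
  have : (0 <= \sum_j rk j [ffun=> true])%E by apply: sume_ge0 => j _; exact: rk0.
  by rewrite rkNy.
pose r j theta := fine (rk j theta).
have rkE j theta : rk j theta = (r j theta)%:E.
  rewrite fineK// ge0_fin_numE//; apply: le_lt_trans (ltry m).
  apply: le_trans (rkm theta); rewrite (bigD1 j)//=.
  by rewrite leeDl// sume_ge0.
have rm theta : \sum_j r j theta <= m.
  rewrite -lee_fin -sumEFin; apply: le_trans (rkm theta).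
  by apply: lee_sum => j _; rewrite rkE.
have re j theta : e <= r j theta + r j (flip j theta).
  by rewrite -lee_fin EFinD -!rkE.
rewrite lee_fin.
pose N : R := #|{ffun 'I_D -> bool}|%:R.
have N0 : 0 < N by rewrite ltr0n; apply/card_gt0P; exists [ffun=> true].
have S1 : \sum_theta \sum_j r j theta <= N * m.
  apply: (@le_trans _ _ (\sum_(theta : {ffun 'I_D -> bool}) m)).
    by apply: ler_sum.
  by rewrite sumr_const mulr_natl.
have S2 j : N * e <= 2 * \sum_theta r j theta.
  rewrite mulr_natl mulr2n {2}(reindex_inj (inv_inj (flipK j)))/= -big_split/=.
  apply: (@le_trans _ _ (\sum_(theta : {ffun 'I_D -> bool}) e)).
    by rewrite sumr_const mulr_natl.
  by apply: ler_sum.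
have S3 : D%:R * (N * e) <= 2 * (N * m).
  apply: (@le_trans _ _ (2 * \sum_theta \sum_j r j theta)); last first.
    by rewrite ler_pM2l.
  rewrite exchange_big mulr_sumr.
  apply: (@le_trans _ _ (\sum_(j < D) N * e)); last exact: ler_sum.
  by rewrite sumr_const card_ord mulr_natl.
rewrite -(ler_pM2l N0); lra.
Qed.

End Assouad.

(** * Rescaled bumps and their cells *)

Section Bumps.
Context {R : realType}.
Variables (phi omega : R -> R) (alpha xi : R).
Hypotheses (alpha0 : 0 < alpha) (xi0 : 0 < xi).
Hypothesis sphi : smooth phi.
Hypothesis supp : exists a b : R,
  [/\ 1/4 < a, b < 3/4 & forall x, x < a \/ b < x -> phi x = 0].
Hypothesis iphi2 : (\int[@lebesgue_measure R]_x ((phi x ^+ 2)%:E) = 1)%E.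
Local Notation leb := (@lebesgue_measure R).

Let phi_eq0 x : ~ (0 <= x < 1) -> phi x = 0.
Proof.
move=> nx; have [a [b [a4 b4 ab]]] := supp; apply: ab.
by have [x0|x0] := ltP x 0; [left; lra | right; have := nx; lra].
Qed.

Lemma continuous_smooth (g : R -> R) : smooth g -> continuous g.
Proof.
by move=> sg x; apply/differentiable_continuous/derivable1_diffP; exact: (sg 0%N).
Qed.

(** [sup] is an upper bound only of a set that is bounded above. Boundedness follows from the
    extreme value theorem on [0, 1], since [phi] vanishes elsewhere. *)
Lemma normr_le_supnorm x : `|phi x| <= supnorm phi.
Proof.
have cphi := continuous_smooth sphi.
have [|c _ cmax] := @EVT_max R (fun x => `|phi x|) 0 1 ler01.
  by apply: continuous_subspaceT => y; apply: continuous_comp;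
    [exact: cphi | exact: norm_continuous].
apply: ub_le_sup; last by exists x.
exists `|phi c| => _ [y _ <-].
have [y01|/negP yn] := boolP (0 <= y < 1); last by rewrite phi_eq0// normr0.
by apply: cmax; rewrite in_itv/=; lra.
Qed.

Lemma supnorm_le_Aconst beta : supnorm phi <= Aconst phi beta.
Proof. exact: (le_bigmax _ _ (ord0 : 'I_(rof beta).+2)). Qed.

Definition rescale (D j : nat) (x : R) : R := D%:R / alpha * (x + alpha / 2) - j%:R.

(** For j < D these are the intervals of length alpha / D that tile [-alpha/2, alpha/2). Being
    half-open they are disjoint, and [0, 1) still contains the support of [phi]. *)
Definition cell (D j : nat) : set R := rescale D j @^-1` `[0, 1[.

Lemma cellE (D j : nat) x : cell D j x = (0 <= rescale D j x < 1) :> Prop.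
Proof. by rewrite /cell/= in_itv. Qed.

Lemma continuous_rescale (D j : nat) : continuous (rescale D j).
Proof.
move=> x; apply: cvgB; last exact: cvg_cst.
apply: cvgM; first exact: cvg_cst.
by apply: cvgD; [exact: cvg_id | exact: cvg_cst].
Qed.

Lemma measurable_cell (D j : nat) : measurable (cell D j).
Proof.
rewrite -[cell D j]setTI.
exact: (continuous_measurable_fun (@continuous_rescale D j)).
Qed.

Lemma cell_disjoint (D j k : nat) x : cell D j x -> cell D k x -> j = k.
Proof.
rewrite !cellE /rescale; set y := _ * _ => /andP[j1 j2] /andP[k1 k2].
by apply/eqP; rewrite eqn_leq; apply/andP; split;
  rewrite -ltnS -(ltr_nat R) -natr1; lra.
Qed.

Lemma trivIset_cell (D : nat) : trivIset setT (fun j : 'I_D => cell D j).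
Proof.
by move=> j k _ _ [x [jx kx]]; apply: val_inj; exact: (cell_disjoint jx kx).
Qed.

Lemma cell_plateau (D j : nat) x : (j < D)%N -> cell D j x ->
  - (3 * alpha / 4) <= x <= 3 * alpha / 4.
Proof.
move=> jD; rewrite cellE /rescale => /andP[x1 x2].
have D0 : 0 < D%:R :> R by rewrite ltr0n; case: D jD {x1 x2}.
have jD' : j%:R + 1 <= D%:R :> R by rewrite natr1 ler_nat.
have j0 : 0 <= j%:R :> R by [].
have a_neq0 : alpha != 0 by rewrite gt_eqF.
have xE : D%:R / alpha * (x + alpha / 2) = D%:R * ((x + alpha / 2) / alpha).
  by field.
set y := (x + alpha / 2) / alpha in xE.
have -> : x = alpha * y - alpha / 2 by rewrite /y; field.
have y0 : 0 <= y by rewrite -(pmulr_rge0 _ D0); lra.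
have y1 : y <= 1 by rewrite -(ler_pM2l D0); lra.
have := mulr_ge0 (ltW alpha0) y0; have : alpha * y <= alpha * 1 by rewrite ler_pM2l.
by move=> *; apply/andP; split; lra.
Qed.

Lemma integral_rescale (D j : nat) : (0 < D)%N ->
  (\int[leb]_x ((phi (rescale D j x) ^+ 2)%:E) = (alpha / D%:R)%:E)%E.
Proof.
move=> D0; set k : R := D%:R / alpha.
have k0 : 0 < k by rewrite divr_gt0// ltr0n.
have dF (x : R) : is_derive x 1 (rescale D j) k.
  rewrite /rescale -/k.
  apply: is_derive_eq; rewrite /GRing.scale/=; ring.
have dFE : (rescale D j)^`()%classic = cst k.
  by apply/funext => x; rewrite derive1E; exact: derive_val.
have cG : continuous (fun x => phi x ^+ 2).
  by move=> x; apply: cvgM; exact: continuous_smooth.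
have : (\int[leb]_x ((phi x ^+ 2)%:E) =
    \int[leb]_x (k%:E * (phi (rescale D j x) ^+ 2)%:E))%E.
  rewrite (@increasing_ge0_integration_by_substitutionT R (rescale D j)
    (fun x => phi x ^+ 2)); rewrite ?dFE//.
  - by apply: eq_integral => x _; rewrite -EFinM mulrC.
  - by move=> x y xy; rewrite ltrD2r ltr_pM2l// ltrD2r.
  - by move=> x; exact: cvg_cst.
  - exact: is_cvg_cst.
  - exact: is_cvg_cst.
  - have -> : rescale D j = (fun x => k * (x + (alpha / 2 - j%:R / k))).
      by apply/funext => x; rewrite /rescale -/k; field; rewrite gt_eqF.
    apply: gt0_cvgMrNy => //.
    apply/cvgrNyPle => A; near=> x.
    rewrite -lerBrDr; near: x; exact: nbhs_ninfty_le.
  - have -> : rescale D j = (fun x => k * (x + (alpha / 2 - j%:R / k))).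
      by apply/funext => x; rewrite /rescale -/k; field; rewrite gt_eqF.
    apply: gt0_cvgMry => //.
    apply/cvgryPge => A; near=> x.
    rewrite -lerBlDr; near: x; exact: nbhs_pinfty_ge.
  - by move=> x; exact: sqr_ge0.
rewrite iphi2 ge0_integralZl_EFin ?ltW//; last 2 first.
- by move=> x _; rewrite lee_fin sqr_ge0.
- apply/measurable_EFinP; apply: (measurableT_comp (continuous_measurable_fun cG)).
  by apply: continuous_measurable_fun; exact: continuous_rescale.
have : (0 <= \int[leb]_x (phi (rescale D j x) ^+ 2)%:E)%E.
  by apply: integral_ge0 => x _; rewrite lee_fin sqr_ge0.
(* The substitution has given 1 = k times the integral; an infinite integral would contradict
   this. *)
case: (\int[leb]_x _)%E => [v| |]//; last first.
  by move=> _; rewrite gt0_muley ?lte_fin.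
move=> _; rewrite -EFinM => -[kv]; congr EFin.
have -> : v = k^-1 * (k * v) by rewrite mulKf// gt_eqF.
by rewrite -kv mulr1 /k invf_div.
Unshelve. all: end_near. Qed.

(** * Amplitude of the bumps and risk over the hypercube *)

Section Amplitude.
Variables (beta : R) (D : nat).
Hypotheses (beta0 : 0 < beta) (D0 : (0 < D)%N) (A1 : 1 < Aconst phi beta).
Local Notation amp := (xi * (D%:R `^ (- beta)) / Aconst phi beta).
Local Notation bump := (phij phi alpha xi beta D).

Let amp0 : 0 <= amp.
Proof.
rewrite divr_ge0 ?mulr_ge0 ?powR_ge0 ?(ltW xi0)//.
exact: le_trans (ltW A1).
Qed.

Let bump_off (j : nat) x : ~ cell D j x -> bump j x = 0.
Proof. by rewrite cellE => nx; rewrite /phij phi_eq0 ?mulr0. Qed.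

(** Division by [Aconst] brings the supremum of |phi| down to at most 1, and D^-beta <= 1. Hence 2
    xi plus or minus a bump stays between xi and 3 xi. *)
Let bump_le (j : nat) x : `|bump j x| <= xi.
Proof.
rewrite /phij normrM ger0_norm//.
have AA : `|phi (D%:R / alpha * (x + alpha / 2) - j%:R)| <= Aconst phi beta.
  exact: le_trans (normr_le_supnorm _) (supnorm_le_Aconst beta).
apply: (@le_trans _ _ (amp * Aconst phi beta)); first exact: ler_wpM2l.
rewrite divfK; last by rewrite gt_eqF// (lt_trans ltr01).
rewrite ger_pMr//; rewrite powRN invf_le1 ?powR_gt0 ?ltr0n//.
apply: (@le_trans _ _ (1 `^ beta)); first by rewrite powR1.
by apply: ge0_ler_powR; rewrite ?nnegrE ?ler1n// ltW.
Qed.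

Let measurable_bump (j : nat) : measurable_fun setT (bump j).
Proof.
apply: measurable_funM; first exact: measurable_cst.
apply: (measurableT_comp (continuous_measurable_fun (continuous_smooth sphi))).
by apply: continuous_measurable_fun; exact: continuous_rescale.
Qed.

(** The common value over j of the integral of phi_j^2 / (2 xi); it equals xi alpha / (2 A^2) D^-(2
    beta + 1). *)
Definition bump_energy : R := amp ^+ 2 * (alpha / D%:R) / (2 * xi).

Let integral_bump (j : nat) :
  (\int[leb]_x ((bump j x ^+ 2 / (2 * xi))%:E) = bump_energy%:E)%E.
Proof.
have xi20 : 0 <= (2 * xi)^-1 by rewrite invr_ge0 mulr_ge0// ltW.
have bumpE x : (bump j x ^+ 2 / (2 * xi))%:E =
    ((amp ^+ 2 / (2 * xi))%:E * (phi (rescale D j x) ^+ 2)%:E)%E.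
  by rewrite -EFinM; congr EFin; rewrite /phij -/(rescale D j x) exprMn mulrAC.
under eq_integral do rewrite bumpE.
have k0 : 0 <= amp ^+ 2 / (2 * xi) by apply: mulr_ge0 => //; exact: sqr_ge0.
rewrite ge0_integralZl_EFin//.
- rewrite integral_rescale// -EFinM; congr EFin.
  by rewrite /bump_energy mulrAC.
- by move=> x _; rewrite lee_fin sqr_ge0.
- apply/measurable_EFinP; apply: measurable_funX.
  apply: (measurableT_comp (continuous_measurable_fun (continuous_smooth sphi))).
  by apply: continuous_measurable_fun; exact: continuous_rescale.
Qed.

Hypothesis plateau : forall x, - (3 * alpha / 4) <= x <= 3 * alpha / 4 -> omega x = 2 * xi.
Local Notation dens := (fun theta : {ffun 'I_D -> bool} =>
  ftheta omega phi alpha xi beta (fun j => theta j)).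

Let sign (b : bool) : R := if b then 1 else -1.

Let dens_on (theta : {ffun 'I_D -> bool}) (j : 'I_D) x : cell D j x ->
  dens theta x = 2 * xi + sign (theta j) * bump j x.
Proof.
move=> jx; rewrite /ftheta (plateau (cell_plateau (ltn_ord j) jx)).
congr (_ + _); rewrite (bigD1 j)//= big1 ?addr0// => k kj.
rewrite bump_off ?mulr0// => kx; move/eqP: kj; apply; apply: val_inj.
exact: (cell_disjoint kx jx).
Qed.

Let dens_off (theta : {ffun 'I_D -> bool}) (j : 'I_D) x : ~ cell D j x ->
  dens theta x = dens (flip j theta) x.
Proof.
move=> jx; rewrite /ftheta; congr (_ + _); apply: eq_bigr => k _.
rewrite ffunE; have [->|//] := eqVneq k j.
by rewrite bump_off// !mulr0.
Qed.

Let dens_pair (theta : {ffun 'I_D -> bool}) (j : 'I_D) :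
  symmetric_pair (cell D j) xi (fun x => sign (theta j) * bump j x)
    (dens theta) (dens (flip j theta)).
Proof.
move=> x; split.
  by rewrite normrM /sign; case: (theta j); rewrite ?normrN normr1 mul1r.
have [jx|jx] := pselect (cell D j x); [left|right].
  split=> //; rewrite !(dens_on _ jx) ffunE eqxx /sign.
  by split=> //; case: (theta j) => /=; ring.
by split=> //; rewrite -(dens_off _ jx) bump_off// mulr0.
Qed.

(** Assouad's bound is applied to the risk measured on cell j alone. Disjointness of the cells
    bounds the sum over j by the full risk, and the two-point bound handles each flip. *)
Lemma hypercube_risk n (est : n.-tuple R -> R -> R) (m : \bar R) :
  estimator est ->
  (forall theta, [/\ measurable_fun setT (dens theta),
     (forall x, 0 < dens theta x) & (\int[leb]_x (dens theta x)%:E = 1)%E]) ->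
  (forall theta, (risk (dens theta) est <= m)%E) ->
  n%:R * bump_energy <= 4^-1 -> bump_energy <= 1 ->
  ((D%:R * (bump_energy / 16) / 2)%:E <= m)%E.
Proof.
move=> est_ densP riskm ne e1.
have mest t : measurable_fun setT (est t).
  by case: est_ => me _; exact: (measurableT_comp me (pair1_measurable t)).
pose rk (j : 'I_D) theta :=
  iexp (dens theta) (fun t => local_loss (cell D j) (dens theta) (est t)).
apply: (@assouad R D rk).
- move=> j theta; have [_ d0 _] := densP theta.
  by apply: iexp_ge0 => [x|t]; [exact: ltW | exact: local_loss_ge0].
- move=> theta; apply: le_trans (riskm theta); have [md d0 _] := densP theta.
  have d0' x := ltW (d0 x).
  rewrite /rk /risk -iexp_sum//; last 2 first.
  - by move=> j; apply: measurable_local_loss => //; exact: measurable_cell.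
  - by move=> j t; exact: local_loss_ge0.
  (* The full loss is the local loss on the whole line, so its measurability is already known. *)
  have mh : measurable_fun setT (fun t => hellinger2 (dens theta) (est t)).
    have mT := measurable_local_loss measurableT md est_.
    apply: eq_measurable_fun mT => t _; rewrite /local_loss /hellinger2.
    by congr (_ * _)%E; apply: eq_integral => x _; rewrite indicT mul1r.
  apply: le_iexp => //.
  - apply: emeasurable_sum => j.
    by apply: measurable_local_loss => //; exact: measurable_cell.
  - by move=> t; apply: sume_ge0 => j _; exact: local_loss_ge0.
  - move=> t; apply: sum_local_loss_le => //; last exact: trivIset_cell.
    by move=> j; exact: measurable_cell.
- move=> j theta; have [md d0 id] := densP theta.
  have [md' d0' id'] := densP (flip j theta).
  apply: (two_point_risk xi0 est_ (measurable_cell D j) md md' _ (dens_pair theta j)) => //.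
    by apply: measurable_funM; first exact: measurable_cst.
  under eq_integral do rewrite exprMn.
  (* The sign disappears on squaring, so the energy is the same at every vertex. *)
  rewrite (_ : sign _ ^+ 2 = 1) ?mul1r; last first.
    by rewrite /sign; case: (theta j); rewrite ?sqrrN expr1n.
  under eq_integral do rewrite mul1r.
  exact: integral_bump.
Qed.

End Amplitude.
End Bumps.

(** * Choice of the resolution *)

Section RateArithmetic.
Context {R : realType}.

(** With x = n^(1 / (2 b + 1)), an even D between K x and 4 K x works. The lower bound gives D^(2 b
    + 1) >= K^(2 b + 1) n >= K n because K >= 1; the upper one controls the negative power. *)
Lemma even_resolution (K b : R) (n : nat) : 0 < b -> 1 <= K -> (1 <= n)%N ->
  exists D : nat, [/\ (0 < D)%N, ~~ odd D,
    K * n%:R <= D%:R `^ (2 * b + 1) &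
    (4 * K) `^ (- (2 * b)) * n%:R `^ (- (2 * b / (2 * b + 1)))
      <= D%:R `^ (- (2 * b))].
Proof.
move=> b0 K1 n1.
have K0 : 0 < K by lra.
have n0 : 1 <= n%:R :> R by rewrite ler1n.
have e0 : 0 < 2 * b + 1 by lra.
pose x : R := n%:R `^ (2 * b + 1)^-1.
have x1 : 1 <= x.
  apply: (@le_trans _ _ (1 `^ (2 * b + 1)^-1)); first by rewrite powR1.
  have e0' : 0 <= (2 * b + 1)^-1 by rewrite invr_ge0 ltW.
  by apply: ge0_ler_powR; rewrite ?nnegrE.
have Kx1 : 1 <= K * x by rewrite -[leLHS]mulr1 ler_pM.
(* The successor puts N above K x, and K x >= 1 keeps it below 2 K x; D is then 2 N. *)
pose N := (Num.truncn (K * x)).+1.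
have [N1 N2] : K * x <= N%:R /\ N%:R <= 2 * (K * x).
  have /truncn_itv/andP[t1 t2] : 0 <= K * x by lra.
  by split; [exact: ltW | rewrite /N -natr1; lra].
have xe : x `^ (2 * b + 1) = n%:R.
  by rewrite /x -powRrM mulVf ?gt_eqF// powRr1.
have DN : N.*2%:R = 2 * N%:R :> R by rewrite -mul2n natrM.
exists N.*2; split; rewrite ?odd_double ?double_gt0//.
  apply: (@le_trans _ _ ((K * x) `^ (2 * b + 1))).
    rewrite powRM ?xe; [|lra|lra].
    by apply: ler_wpM2r => //; apply: le1r_powR => //; lra.
  by apply: ge0_ler_powR; rewrite ?nnegrE ?DN; lra.
have -> : n%:R `^ (- (2 * b / (2 * b + 1))) = x `^ (- (2 * b)).
  by rewrite /x -powRrM; congr (_ `^ _); field; rewrite gt_eqF.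
rewrite -powRM; [|lra|lra].
have X0 : 0 < 4 * K * x by lra.
have D0 : 0 < N.*2%:R :> R by lra.
rewrite !powRN lef_pV2 ?posrE ?powR_gt0//.
by apply: ge0_ler_powR; rewrite ?nnegrE; lra.
Qed.

(** Meant for v = xi alpha and P = D^(2 beta + 1): as A > 1 the energy is at most v / (2 P), and 2 v
    n <= P bounds n times it by 1/4. *)
Lemma energy_small (n P A v : R) : 0 <= n -> 0 < v -> 1 < A -> 0 < P ->
  (1 + 2 * v) * n <= P -> n * (v / (2 * A ^+ 2) / P) <= 4^-1.
Proof.
move=> n0 v0 A1 P0 nP.
have A2 : 1 <= A ^+ 2 by rewrite exprn_ege1// ltW.
have vA : v / (2 * A ^+ 2) <= v / 2 by rewrite ler_pdivrMr; nra.
rewrite mulrA ler_pdivrMr//.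
have := ler_wpM2l n0 vA; lra.
Qed.

End RateArithmetic.

(** * Assembly of the minimax lower bound *)

Unset Implicit Arguments.
Set Strict Implicit.

Theorem theorem3 (R : realType) (beta_lo beta_hi alpha xi : R)
  (phi omega : R -> R) (Lt : {poly R}) (epst Ct Mt : R) (P' : @params R) :
  0 < beta_lo -> beta_lo < beta_hi -> 0 < alpha -> 0 < xi ->
  (* phi : C^oo, compact support in (1/4,3/4), int phi = 0, int phi^2 = 1 *)
  smooth phi ->
  (exists a b : R, [/\ 1/4 < a, b < 3/4 &
      forall x, x < a \/ b < x -> phi x = 0]) ->
  (\int[@lebesgue_measure R]_x ((phi x)%:E) = 0)%E ->
  (\int[@lebesgue_measure R]_x ((phi x ^+ 2)%:E) = 1)%E ->
  (forall beta, beta_lo <= beta <= beta_hi -> 1 < Aconst phi beta) ->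
  (* omega in T(alpha,xi) /\ H(beta, P~) for every beta *)
  Tset alpha xi omega ->
  (forall beta, beta_lo <= beta <= beta_hi ->
     Hclass beta (Params (alpha / 4) (ln (2 * xi)) Lt epst Ct alpha xi Mt)
       omega) ->
  (* J(beta,D) is included in H(beta,P') *)
  (forall beta, beta_lo <= beta <= beta_hi ->
   forall D : nat, (0 < D)%N -> ~~ odd D ->
     Jset omega phi alpha xi beta D `<=` Hclass beta P') ->
  forall beta, beta_lo <= beta <= beta_hi ->
  exists kappa : R, 0 < kappa /\
    forall n : nat, (1 <= n)%N ->
    forall est : n.-tuple R -> R -> R, estimator est ->
      ((kappa * n%:R `^ (- (2 * beta / (2 * beta + 1))))%:E
        <= ereal_sup [set risk s est | s in Hclass beta P'])%E.
Proof.
move=> blo0 blohi alpha0 xi0 sphi supp iphi iphi2 A1 wT wH J beta betaI.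
have b0 : 0 < beta by case/andP: betaI => + _; exact: lt_le_trans.
have {}A1 := A1 _ betaI.
set A := Aconst phi beta in A1.
have A0 : 0 < A by exact: lt_trans A1.
(* The summand 1 ensures K >= 1, and 2 xi alpha is what n e <= 1/4 requires. *)
pose K : R := 1 + 2 * xi * alpha.
have xa0 : 0 < xi * alpha by exact: mulr_gt0.
have K1 : 1 <= K by rewrite /K; lra.
(* The factor 64 is 2 from the energy times the 32 of D e / 32; thus D e / 32 = c D^(-2 beta). *)
pose c : R := xi * alpha / (64 * A ^+ 2).
have c0 : 0 < c by rewrite divr_gt0 ?mulr_gt0 ?exprn_gt0.
exists (c * (4 * K) `^ (- (2 * beta))); split.
  by rewrite mulr_gt0// powR_gt0; lra.
move=> n n1 est est_.
have [D [D0 Deven Dlo Dhi]] := even_resolution b0 K1 n1.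
have D0' : 0 < D%:R :> R by rewrite ltr0n.
set e := bump_energy phi alpha xi beta D.
have eE : e = xi * alpha / (2 * A ^+ 2) / (D%:R `^ (2 * beta + 1)).
  rewrite /e /bump_energy -/A powRD; last by rewrite (gt_eqF D0') implybT.
  rewrite powRr1 ?ltW// powRN mulrC [2 * beta]mulrC powRrM.
  set y := D%:R `^ beta; have y0 : y != 0 by rewrite gt_eqF ?powR_gt0.
  rewrite -[2]/(2%:R) powR_mulrn ?powR_ge0//.
  by field; rewrite y0 !gt_eqF.
have P0 : 0 < D%:R `^ (2 * beta + 1) by exact: powR_gt0.
have e_le : n%:R * e <= 4^-1.
  by rewrite eE; apply: energy_small => //; rewrite /K -mulrA in Dlo.
have n1' : 1 <= n%:R :> R by rewrite ler1n.
have e0 : 0 <= e by rewrite eE divr_ge0 ?divr_ge0 ?mulr_ge0 ?sqr_ge0 ?powR_ge0 ?ltW.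
have e1 : e <= 1 by nra.
(* Every vertex lies in the class. This supplies normalisation and positivity of the densities, and
   places their risks below the supremum. *)
have JH (theta : {ffun 'I_D -> bool}) :
    Hclass beta P' (ftheta omega phi alpha xi beta (fun j => theta j)).
  by apply: (J _ betaI _ D0 Deven); exists (fun j => theta j).
have plateau : forall x, - (3 * alpha / 4) <= x <= 3 * alpha / 4 -> omega x = 2 * xi.
  by case: wT => _ [_ [_ []]].
have := @hypercube_risk R phi omega alpha xi alpha0 xi0 sphi supp iphi2 beta D
  b0 D0 A1 plateau n est (ereal_sup [set risk s est | s in Hclass beta P']) est_.
rewrite -/e => H.
apply: le_trans (H _ _ e_le e1).
- rewrite lee_fin -mulrA.
  apply: (@le_trans _ _ (c * D%:R `^ (- (2 * beta)))).
    by apply: ler_wpM2l; rewrite ?(ltW c0).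
  rewrite eE powRD; last by rewrite (gt_eqF D0') implybT.
  rewrite powRr1 ?(ltW D0')// powRN /c.
  set y := D%:R `^ (2 * beta); have y0 : y != 0 by rewrite gt_eqF ?powR_gt0.
  suff -> : xi * alpha / (64 * A ^+ 2) * y^-1 =
    D%:R * (xi * alpha / (2 * A ^+ 2) / (y * D%:R) / 16) / 2 by [].
  by field; rewrite y0 !gt_eqF.
- move=> theta; have [[md d0 id] [_ [_ [_ [_ [_ [_ [dp _]]]]]]]] := JH theta.
  by split.
- move=> theta; apply: ereal_sup_ubound.
  by exists (ftheta omega phi alpha xi beta (fun j => theta j)).
Qed.
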